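(* (1) For any $k\ge2$ and $n\ge5$ there is no $(k,n)$ choice strategy that is stochastically optimal for maximizing $L$. (2) However, for each $k\ge2$ and $n\ge4$ there exists a $(k,n)$ choice strategy $\mathcal{S}_{copy}$ which is strictly better than the $k$-card-minimum strategy $\mathcal{S}_{\min}$ for maximizing $L$, that is, $$\mathbb{P}^{\mathcal{S}_{copy}}_{n,k}(L\ge x)\ge\mathbb{P}^{\mathcal{S}_{\min}}_{n,k}(L\ge x)$$ for all $x\in\mathbb{R}$, with strict inequality for some values of $x$.
   Context: $k,n$ are positive integers and $[n]=\{1,\dots,n\}$. A $(k,n)$ choice strategy is an $n$-tuple $\mathcal{S}=(f_1,\dots,f_n)$ of functions such that for each $t\in[n]$: the domain of $f_t$ is the set of pairs $((c_1,\dots,c_{t-1}),(c_{t,1},\dots,c_{t,k}))$ with all $c_\tau,c_{t,i}\in[n]$, $c_\tau\ne c_{\tau'}$ for $\tau\neq\tau'$, and $c_{t,i}\ne c_\tau$ for all $1\le i\le k$, $1\le\tau\le t-1$; and $f_t$ always takes a value in $\{c_{t,1},\dots,c_{t,k}\}$. Given such an $\mathcal{S}$, a random permutation $\sigma=(C_1,\dots,C_n)$ of $[n]$ is generated as follows: $D_1=[n]$; for $t=1,\dots,n$, given the past, $C_{t,1},\dots,C_{t,k}$ are i.i.d. uniform on $D_t$, then $C_t=f_t[((C_1,\dots,C_{t-1}),(C_{t,1},\dots,C_{t,k}))]$ and $D_{t+1}=D_t\setminus\{C_t\}$. $\mathbb{P}^{\mathcal{S}}_{n,k}$ denotes the corresponding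 probability measure. The $k$-card-minimum strategy $\mathcal{S}_{\min}$ is the strategy with $f_t[((c_1,\dots,c_{t-1}),(c_{t,1},\dots,c_{t,k}))]=\min\{c_{t,1},\dots,c_{t,k}\}$ for every $t$. $L=L(\sigma)=\max\{\ell:\exists\,1\le i_1<\dots<i_\ell\le n\text{ with }\sigma(i_1)<\dots<\sigma(i_\ell)\}$ is the length of the longest increasing subsequence of $\sigma$. A $(k,n)$ choice strategy $\mathcal{S}$ is stochastically optimal for maximizing $L$ if for every other $(k,n)$ choice strategy $\hat{\mathcal{S}}$ one has $\mathbb{P}^{\mathcal{S}}_{n,k}(L\ge x)\ge\mathbb{P}^{\hat{\mathcal{S}}}_{n,k}(L\ge x)$ for all $x\in\mathbb{R}$. *)

(* Defs.v *)
From HB Require Import structures.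
From mathcomp Require Import all_boot all_order all_fingroup all_algebra.
From mathcomp Require Import reals.

Set Implicit Arguments.
Unset Strict Implicit.
Unset Printing Implicit Defensive.

Import Order.TTheory GRing.Theory Num.Theory.

(* The cards [n] = {1, ..., n} and the times 1, ..., n are both represented,
   shifted by one, by 'I_n. *)

(* The pairs (past, u) with |past| = t - 1 that satisfy this predicate form the
   domain of f_t; for k > 0 it forces |past| < n. *)
Definition admissible (k n : nat) (past : seq 'I_n) (u : k.-tuple 'I_n) : bool :=
  uniq past && all (fun c => c \notin past) u.

(* The functions f_1, ..., f_n are bundled into one function, f_t being its
   restriction to pasts of length t - 1. Values at non-admissible pairs are
   arbitrary and do not influence the law below. *)
Record strategy (k n : nat) := Strategy {
  choice_fun :> seq 'I_n -> k.-tuple 'I_n -> 'I_n;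
  choice_funP : forall (past : seq 'I_n) (u : k.-tuple 'I_n),
    admissible past u -> choice_fun past u \in u
}.

Definition min_card (k n : nat) (hk : 0 < k) (u : k.-tuple 'I_n) : 'I_n :=
  tnth u [arg min_(i < Ordinal hk) (tnth u i : nat)].

Definition card_min_strategy (k n : nat) (hk : 0 < k) : strategy k n :=
  @Strategy k n (fun _ u => min_card hk u) (fun _ u _ => mem_tnth _ u).

Definition available (n : nat) (past : seq 'I_n) : {set 'I_n} :=
  [set c | c \notin past].

Local Open Scope ring_scope.

Definition uniform_pmf (R : realType) (T : finType) (D : {set T}) (c : T) : R :=
  if c \in D then #|D|%:R^-1 else 0.

Definition draws_pmf (R : realType) (k n : nat) (past : seq 'I_n)
    (u : k.-tuple 'I_n) : R :=
  \prod_(i < k) uniform_pmf R (available past) (tnth u i).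

(* conditional probability of C_t = c given (C_1, ..., C_(t-1)) = past *)
Definition next_pmf (R : realType) (k n : nat) (S : strategy k n)
    (past : seq 'I_n) (c : 'I_n) : R :=
  \sum_(u : k.-tuple 'I_n | S past u == c) draws_pmf R past u.

Definition past_of (n : nat) (s : {perm 'I_n}) (t : nat) : seq 'I_n :=
  take t [seq s i | i <- enum 'I_n].

Definition perm_pmf (R : realType) (k n : nat) (S : strategy k n)
    (s : {perm 'I_n}) : R :=
  \prod_(t < n) next_pmf R S (past_of s t) (s t).

Definition Pr (R : realType) (k n : nat) (S : strategy k n)
    (A : pred {perm 'I_n}) : R :=
  \sum_(s : {perm 'I_n} | A s) perm_pmf R S s.

Definition has_increasing_subseq (n : nat) (s : {perm 'I_n}) (l : nat) : bool :=
  [exists i : l.-tuple 'I_n,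
    sorted ltn [seq val j | j <- i] && sorted ltn [seq val (s j) | j <- i]].

(* longest increasing subsequence; lengths cannot exceed n *)
Definition lis (n : nat) (s : {perm 'I_n}) : nat :=
  (\max_(l < n.+1 | has_increasing_subseq s l) l)%N.

Definition Pr_lis_ge (R : realType) (k n : nat) (S : strategy k n) (x : R) : R :=
  Pr R S (fun s => x <= (lis s)%:R).

Definition stochastically_optimal (R : realType) (k n : nat)
    (S : strategy k n) : Prop :=
  forall (S' : strategy k n) (x : R), Pr_lis_ge S' x <= Pr_lis_ge S x.

Definition strictly_better (R : realType) (k n : nat)
    (S S' : strategy k n) : Prop :=
  (forall x : R, Pr_lis_ge S' x <= Pr_lis_ge S x) /\
  (exists x : R, Pr_lis_ge S' x < Pr_lis_ge S x).

(* Main.v *)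
Require Import Defs.
From mathcomp Require Import all_boot all_order all_fingroup all_algebra.
From mathcomp Require Import reals.

Set Implicit Arguments.
Unset Strict Implicit.
Unset Printing Implicit Defensive.

Import Order.TTheory GRing.Theory Num.Theory.

(** Both parts compare a strategy S with a strategy S' obtained from S by
    changing one single decision: after the past p, on the draw u0 made of two
    cards a and b only, S takes a and S' takes b. Conditioning on the past shows
      Pr S' A - Pr S A = w * (V (p b) - V (p a)),
    where V q is the conditional probability of A given that the permutation
    starts with q, computed under S, and w > 0 is the probability of meeting
    the draw u0 after p ([Pr_switch]). Beyond p b and p a the two strategies
    agree, so V is the same for both. Every card that is still available has
    positive probability of being taken next, whatever the strategy: the k drawn
    cards may all be equal to it. Hence V q < 1 or V q > 0 as soon as some
    continuation of q avoids A, respectively leads to A, and only a few facts on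
    L are needed. Below, p consists of the m smallest cards in increasing order
    and of one more card; the cards other than these m are written 0, 1, 2, ...
    in increasing order, and the initial m cards, which belong to every longest
    increasing subsequence, are left out.

    No optimal strategy, n = m + 5. Let p end with 2, and let the draw consist
    of the cards 0 and 3. If 3 is taken, L = m + 3 whatever follows:
    2 < 3 < 4 is increasing, while 2 and 3 both come before 0 and 1. If 0 is
    taken, the result is a gamble: 2 0 1 3 4 gives L = m + 4 but 2 0 4 3 1 gives
    L = m + 2. So taking 0 is strictly better for the event L >= m + 4, and
    taking 3 is strictly better for the event L >= m + 3; an optimal strategy
    could do neither.

    Improving the minimum strategy, n = m + 4. Let p end with 1, and let the draw
    consist of the cards 0 and 2. The minimum strategy takes 0, after
    which L <= m + 3, with L <= m + 2 in case of 1 0 3 2. Taking 2 ensures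
    L >= m + 3. So the change does no harm for any threshold, and is a strict
    gain for the threshold m + 3. *)

(** * Longest increasing subsequences from the positions of the cards *)

Definition word (n : nat) (s : {perm 'I_n}) : seq 'I_n :=
  [seq s i | i <- enum 'I_n].

Lemma size_word n (s : {perm 'I_n}) : size (word s) = n.
Proof. by rewrite size_map size_enum_ord. Qed.

Lemma index_word n (s : {perm 'I_n}) (v : 'I_n) :
  index v (word s) = (s^-1)%g v.
Proof.
by rewrite -{1}(permKV s v) (index_map (@perm_inj _ s)) index_enum_ord.
Qed.

(** A prefix of the permutation orders its own cards among each other and before
    all the others; [index] captures both, as it sends the cards outside q to
    [size q]. *)
Lemma precedes_of_prefix n (s : {perm 'I_n}) (q : seq 'I_n) (u v : 'I_n) :
  prefix q (word s) -> index u q < index v q -> (s^-1)%g u < (s^-1)%g v.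
Proof.
move=> /prefixP[r def_s] lt_uv; rewrite -!index_word def_s !index_cat.
have uq : u \in q by rewrite -index_mem (leq_trans lt_uv) ?index_size.
by rewrite uq; case: ifP => // _; rewrite ltn_addr ?index_mem.
Qed.

(** An increasing subsequence is given here by its values instead of its
    positions, since these are what the bounds below exhibit. *)
Lemma size_le_lis n (s : {perm 'I_n}) (V : seq 'I_n) :
  sorted ltn [seq val v | v <- V] -> sorted ltn [seq val ((s^-1)%g v) | v <- V] ->
  size V <= lis s.
Proof.
move=> incV incP.
have leVn : size V < n.+1.
  have /map_uniq/card_uniqP <- := sorted_uniq ltn_trans ltnn incV.
  by rewrite ltnS -[leqRHS]card_ord max_card.
have hV : has_increasing_subseq s (Ordinal leVn).
  apply/existsP; exists (map_tuple (s^-1)%g (in_tuple V)).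
  rewrite -!map_comp /= incP /=.
  by rewrite (eq_map (g := val)) // => v /=; rewrite permKV.
exact: (leq_bigmax_cond (F := @nat_of_ord _) (Ordinal leVn)).
Qed.

(** Each color class is a decreasing subsequence, which an increasing one meets at
    most once. *)
Lemma lis_le_colors n (s : {perm 'I_n}) (color : 'I_n -> nat) (d : nat) :
  (forall v, color v < d) ->
  (forall u v : 'I_n, u < v -> color u = color v -> (s^-1)%g v < (s^-1)%g u) ->
  lis s <= d.
Proof.
move=> ltcd decr; apply/bigmax_leqP => l /existsP[i /andP[incP incV]].
rewrite -(size_tuple i) -(size_map (color \o s)) -[leqRHS](size_iota 0).
apply: uniq_leq_size; last first.
  by move=> _ /mapP[j _ ->]; rewrite mem_iota /= add0n ltcd.
rewrite uniq_pairwise pairwise_map.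
move: incP incV; rewrite !(sorted_pairwise ltn_trans) !pairwise_map.
move=> incP incV.
have := conj incP incV => /andP; rewrite -pairwise_relI.
apply: sub_pairwise => x y /= /andP[ltxy ltsxy].
apply/eqP => eqc; move: (decr _ _ ltsxy eqc).
by rewrite !permK ltnNge ltnW.
Qed.

(** * Permutations that start with the smallest cards in order *)

Section TailWords.

Variables (m J : nat).

(** The word 0, ..., m-1 followed by the cards m + j for j in w. The deck has
    m + J + 1 cards, so that its tail cards are indexed by 0, ..., J and all the
    conditions on the tail are decided by computation, uniformly in m. *)
Definition tail_word (w : seq nat) : seq 'I_(m + J).+1 :=
  [seq inord x | x <- iota 0 m ++ [seq m + j | j <- w]].

Variable w : seq nat.
Hypothesis ltw : all (leq^~ J) w.

Lemma val_tail_word :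
  [seq val v | v <- tail_word w] = iota 0 m ++ [seq m + j | j <- w].
Proof.
rewrite -map_comp -[RHS]map_id; apply/eq_in_map => x.
rewrite mem_cat mem_iota /= add0n => /orP[ltxm | /mapP[j /(allP ltw) lejJ ->]].
  by rewrite inordK // ltnS ltnW // ltn_addr.
by rewrite inordK // ltnS leq_add2l.
Qed.

Lemma size_tail_word : size (tail_word w) = m + size w.
Proof. by rewrite size_map size_cat size_iota size_map. Qed.

Lemma uniq_tail_word : uniq w -> uniq (tail_word w).
Proof.
move=> uw; rewrite -(map_inj_uniq val_inj) val_tail_word cat_uniq iota_uniq.
rewrite map_inj_uniq ?uw ?andbT; last exact: addnI.
apply/hasPn => _ /mapP[j _ ->].
by rewrite mem_iota /= add0n -ltnNge ltnS leq_addr.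
Qed.

Lemma index_tail_word (v : 'I_(m + J).+1) :
  index v (tail_word w) = if v < m then val v else m + index (v - m) w.
Proof.
rewrite -(index_map val_inj) val_tail_word index_cat mem_iota /= add0n.
case: ltnP => [ltvm | lemv].
  have sz : v < size (iota 0 m) by rewrite size_iota.
  by rewrite -[X in index X](nth_iota 0 0 ltvm) index_uniq ?iota_uniq.
by rewrite size_iota -{1}(subnKC lemv) (index_map (@addnI m)).
Qed.

Lemma inord_tail j : j <= J -> (inord (m + j) : 'I_(m + J).+1) = m + j :> nat.
Proof. by move=> lejJ; rewrite inordK // ltnS leq_add2l. Qed.

End TailWords.

Lemma rcons_tail_word m J w j :
  rcons (tail_word m J w) (inord (m + j)) = tail_word m J (rcons w j).
Proof. by rewrite /tail_word map_rcons -rcons_cat map_rcons. Qed.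

Lemma mem_tail_word m J w j : all (leq^~ J) w -> (j <= J)%N ->
  (inord (m + j) \in tail_word m J w) = (j \in w).
Proof.
move=> lew lej; rewrite -(mem_map val_inj) val_tail_word //= inord_tail //.
by rewrite mem_cat mem_iota /= add0n ltnNge leq_addr (mem_map (@addnI m)).
Qed.

Lemma prefix_tail_word m J w w' : prefix w w' -> prefix (tail_word m J w) (tail_word m J w').
Proof.
by move=> /prefixP[r ->]; rewrite /tail_word !map_cat catA prefix_prefix.
Qed.

Lemma pairwise_tail (e : rel nat) m (K : seq nat) :
  (forall x y, x < y < m -> e x y) -> (forall x j, x < m -> e x (m + j)) ->
  pairwise (fun i j => e (m + i) (m + j)) K ->
  pairwise e (iota 0 m ++ [seq m + j | j <- K]).
Proof.
move=> ehead ecross etail; rewrite pairwise_cat pairwise_map etail andbT.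
apply/andP; split.
  apply/allrelP => x _ + /mapP[j _ ->].
  by rewrite mem_iota => /andP[_ ltxm]; apply: ecross.
have /pairwiseP : pairwise ltn (iota 0 m).
  by rewrite -(sorted_pairwise ltn_trans) iota_ltn_sorted.
move=> /(_ 0) iotaP; apply/(pairwiseP 0) => i j.
rewrite !inE size_iota => ltim ltjm ltij.
by rewrite !nth_iota // !add0n ehead // ltij.
Qed.

(** The cards 0, ..., m-1 followed by the tail cards listed in K form an increasing
    subsequence. The bound covers every completion of the prefix: a card of K
    missing from w has index [size w], so at most the last one may be missing. *)
Lemma lis_ge_tail m J (w K : seq nat) (s : {perm 'I_(m + J).+1}) :
  all (leq^~ J) w -> all (leq^~ J) K ->
  pairwise (fun i j => (i < j) && (index i w < index j w)) K ->
  prefix (tail_word m J w) (word s) -> m + size K <= lis s.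
Proof.
move=> ltw ltK incK pre; rewrite -(size_tail_word m J).
apply: size_le_lis.
  rewrite val_tail_word // (sorted_pairwise ltn_trans).
  apply: pairwise_tail => [x y /andP[] // | x j ltxm | ].
    by rewrite /= ltn_addr.
  by apply: sub_pairwise incK => i j /andP[ltij _]; rewrite /= ltn_add2l.
rewrite (sorted_pairwise ltn_trans) pairwise_map.
have ge_m j : (m + j < m) = false by rewrite ltnNge leq_addr.
pose pos x := if x < m then x else m + index (x - m) w.
have : pairwise (relpre pos ltn) (iota 0 m ++ [seq m + j | j <- K]).
  apply: pairwise_tail => [x y /andP[ltxy ltym] | x j ltxm | ] /=.
  - by rewrite /pos ltym (ltn_trans ltxy).
  - by rewrite /pos ltxm ge_m ltn_addr.
  apply: sub_pairwise incK => i j /andP[_ lt_ij].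
  by rewrite /= /pos !ge_m !addKn ltn_add2l.
rewrite -(val_tail_word m ltK) pairwise_map; apply: sub_pairwise => u v /=.
by rewrite /pos -!index_tail_word //; apply: precedes_of_prefix.
Qed.

(** Each of the cards 0, ..., m-1 gets a color of its own, the tail cards share d
    more colors. A same-colored pair must be ordered by w alone, for the bound to
    hold for every completion of the prefix. *)
Lemma lis_le_tail m J (w : seq nat) (color : nat -> nat) (d : nat)
    (s : {perm 'I_(m + J).+1}) :
  all (leq^~ J) w ->
  all (fun j => color j < d) (iota 0 J.+1) ->
  pairwise (fun i j => (color i == color j) ==> (index j w < index i w))
    (iota 0 J.+1) ->
  prefix (tail_word m J w) (word s) -> lis s <= m + d.
Proof.
move=> ltw ltcd decr pre.
apply: (lis_le_colors (color := fun v => if v < m then val v else m + color (v - m))).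
  move=> v /=; case: (ltnP v m) => [ltvm | lemv]; first by rewrite ltn_addr.
  rewrite ltn_add2l (allP ltcd) // mem_iota /= add0n ltnS leq_subLR.
  by rewrite -ltnS.
move=> u v ltuv; case: (ltnP u m) => [ltum | lemu].
  case: (ltnP v m) => [_ eq_uv | _ eq_u]; first by rewrite eq_uv ltnn in ltuv.
  by rewrite eq_u ltnNge leq_addr in ltum.
have lemv : m <= v by exact: leq_trans lemu (ltnW ltuv).
rewrite (ltnNge v) lemv /= => /addnI eqc.
apply: precedes_of_prefix pre _; rewrite !index_tail_word //.
rewrite (ltnNge v) (ltnNge u) lemu lemv /= ltn_add2l.
have lt_tail (x : 'I_(m + J).+1) : m <= x -> x - m < J.+1.
  by move=> _; rewrite ltnS leq_subLR -ltnS.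
have /(pairwiseP 0) decr' := decr.
have := decr' (u - m) (v - m); rewrite !inE size_iota !nth_iota ?lt_tail //.
by rewrite !add0n eqc eqxx /=; apply=> //; rewrite ltn_sub2r // (leq_ltn_trans lemu).
Qed.

(** * The law of the permutation, conditioned on its beginning *)

Local Open Scope ring_scope.

Section Law.

Variables (R : realType) (k n : nat).
Implicit Types (S : strategy k n) (q r : seq 'I_n) (u : k.-tuple 'I_n).
Implicit Types (s : {perm 'I_n}) (A : pred {perm 'I_n}).

Lemma nth_word s (i : 'I_n) c : nth c (word s) i = s i.
Proof. by rewrite (nth_map i) ?nth_ord_enum // size_enum_ord. Qed.

Lemma uniq_word s : uniq (word s).
Proof. by rewrite map_inj_uniq ?enum_uniq //; apply: perm_inj. Qed.

Lemma prefix_rcons_word q c s (i : 'I_n) : i = size q :> nat ->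
  prefix (rcons q c) (word s) = prefix q (word s) && (s i == c).
Proof.
move=> def_i; rewrite !prefixE size_rcons (take_nth c); last first.
  by rewrite size_word -def_i.
by rewrite eqseq_rcons -def_i nth_word.
Qed.

Lemma draws_ge0 q u : 0 <= draws_pmf R q u.
Proof.
by apply: prodr_ge0 => i _; rewrite /uniform_pmf; case: ifP; rewrite ?invr_ge0 ?ler0n.
Qed.

Lemma draws_gt0 q u : admissible q u -> 0 < draws_pmf R q u.
Proof.
move=> /andP[_ /all_tnthP freeu]; apply: prodr_gt0 => i _.
have freei : tnth u i \in available q by rewrite inE freeu.
rewrite /uniform_pmf freei invr_gt0 ltr0n card_gt0.
by apply/set0Pn; exists (tnth u i).
Qed.

Lemma draws_eq0 q u : ~~ all (fun c => c \notin q) u -> draws_pmf R q u = 0.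
Proof.
move=> /allPn[c /tnthP[i ->] takeni]; rewrite /draws_pmf (bigD1 i) //=.
by rewrite /uniform_pmf inE (negbTE takeni) mul0r.
Qed.

Lemma sum_draws q : (exists c, c \notin q) -> \sum_(u : k.-tuple 'I_n) draws_pmf R q u = 1.
Proof.
move=> [c freec].
pose tup (f : {ffun 'I_k -> 'I_n}) := [tuple f i | i < k].
rewrite (reindex tup) /=; last first.
  exists (fun u => [ffun i => tnth u i]) => [f _ | u _].
    by apply/ffunP => i; rewrite ffunE tnth_mktuple.
  by apply: eq_from_tnth => i; rewrite tnth_mktuple ffunE.
transitivity (\prod_(i < k) \sum_(d : 'I_n) uniform_pmf R (available q) d).
  rewrite bigA_distr_bigA; apply: eq_bigr => f _.
  by apply: eq_bigr => i _; rewrite tnth_mktuple.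
apply: big1 => i _; rewrite -big_mkcond sumr_const -[_ *+ _]mulr_natr mulVf //.
rewrite pnatr_eq0 -lt0n card_gt0.
by apply/set0Pn; exists c; rewrite inE.
Qed.

(** The k drawn cards may all be equal to c, which leaves no choice. *)
Lemma next_gt0 S q c : uniq q -> c \notin q -> 0 < next_pmf R S q c.
Proof.
move=> uq freec; pose u := nseq_tuple k c.
have adm : admissible q u.
  by rewrite /admissible uq; apply/allP => d /nseqP[-> _].
have /nseqP[Su _] := choice_funP S adm.
rewrite /next_pmf (bigD1 u) ?Su //= ltr_wpDr ?draws_gt0 // sumr_ge0 // => v _.
exact: draws_ge0.
Qed.

(** The probability that, after the past q, the next cards taken are those of r. *)
Fixpoint path_pmf S q r : R :=
  if r is c :: r' then next_pmf R S q c * path_pmf S (rcons q c) r' else 1.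

Lemma path_gt0 S q r : uniq (q ++ r) -> 0 < path_pmf S q r.
Proof.
elim: r q => //= c r IHr q uqr.
rewrite mulr_gt0 ?IHr ?cat_rcons //.
move: uqr; rewrite cat_uniq => /and3P[uq /hasPn notq _].
by rewrite next_gt0 // notq ?mem_head.
Qed.

Lemma path_pmf_word S s q r : q ++ r = word s ->
  path_pmf S q r = \prod_(t < n | (size q <= t)%N) next_pmf R S (past_of s t) (s t).
Proof.
elim: r q => [|c r IHr] q def_s /=.
  rewrite big_pred0 // => t; apply/negbTE.
  have szq : size q = n by rewrite -[q]cats0 def_s size_word.
  by rewrite -ltnNge szq.
have ltqn : (size q < n)%N.
  have := eq_leq (size_word s); rewrite -def_s size_cat.
  by apply: leq_trans; rewrite addnS ltnS leq_addr.
rewrite (bigD1 (Ordinal ltqn)) //= IHr ?cat_rcons // size_rcons; congr (_ * _).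
  rewrite /past_of -/(word s) -def_s take_size_cat // -(nth_word _ _ c) -def_s.
  by rewrite nth_cat ltnn subnn.
by apply: eq_bigl => t; rewrite ltn_neqAle andbC eq_sym.
Qed.

(** The conditional probability of A given that the permutation starts with q,
    as a sum over the completions of q; it involves no division and makes sense
    without knowing that q has positive probability. *)
Definition cond_pr S q A : R :=
  \sum_(s | prefix q (word s) && A s) path_pmf S q (drop (size q) (word s)).

Lemma Pr_cond_pr S A : Pr R S A = cond_pr S [::] A.
Proof.
apply: eq_big => [s | s _]; first by rewrite prefix0s.
by rewrite drop0 (@path_pmf_word _ s).
Qed.

(** The law of the next card is the image of the law of the draw. Draws that meet q
    have probability 0, and all the others force a choice outside q. *)
Lemma sum_next S q (V : 'I_n -> R) : uniq q ->
  \sum_(c | c \notin q) next_pmf R S q c * V c =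
  \sum_(u : k.-tuple 'I_n) draws_pmf R q u * V (S q u).
Proof.
move=> uq; rewrite [RHS](bigID (fun u => S q u \notin q)) /=.
rewrite [X in _ = _ + X]big1 ?addr0 => [|u]; last first.
  rewrite negbK => takenS; rewrite draws_eq0 ?mul0r //.
  apply: contraL takenS => freeu; apply: (allP freeu).
  by apply: choice_funP; rewrite /admissible uq.
rewrite (partition_big (S q) (fun c => c \notin q)) //=.
apply: eq_bigr => c freec; rewrite /next_pmf mulr_suml; apply: eq_big => [u | u].
  by case: eqP => [-> | _]; rewrite ?freec ?andbF.
by move=> /eqP->.
Qed.

(** The completions of q are sorted by their next card, whose law [sum_next]
    expresses through the draw. *)
Lemma cond_pr_draw S q A : uniq q -> (size q < n)%N ->
  cond_pr S q A = \sum_(u : k.-tuple 'I_n) draws_pmf R q u * cond_pr S (rcons q (S q u)) A.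
Proof.
move=> uq ltqn; rewrite -(@sum_next S q (fun c => cond_pr S (rcons q c) A)) //.
pose i := Ordinal ltqn.
have def_q c s := @prefix_rcons_word q c s i (erefl _).
rewrite /cond_pr (partition_big (fun s => s i) (fun c => c \notin q)) /=; last first.
  move=> s /andP[pre _]; have := @prefix_uniq _ (rcons q (s i)) (word s).
  by rewrite def_q pre eqxx rcons_uniq uniq_word => /(_ isT isT)/andP[].
apply: eq_bigr => c _; rewrite big_distrr /=; apply: eq_big => s.
  by rewrite def_q andbAC.
move=> /andP[_ /eqP sic]; rewrite (drop_nth c) ?size_word // size_rcons.
by rewrite (nth_word s i) sic.
Qed.

(** Backward induction on the length of q by [cond_pr_draw], starting from the
    words of length n, each of which has exactly one completion. *)
Lemma cond_pr_total S q : uniq q -> cond_pr S q predT = 1.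
Proof.
have [d] := ubnP (n - size q)%N; elim: d q => // d IHd q ltd uq.
have leqn : (size q <= n)%N.
  by rewrite -(card_uniqP uq) -[leqRHS]card_ord max_card.
have [ltqn | geqn] := ltnP (size q) n; last first.
  have szq : size q == n by rewrite eqn_leq leqn.
  have inj_q : injective (tnth (Tuple szq)) by exact/tuple_uniqP.
  have def_q : word (perm inj_q) = q.
    rewrite /word (eq_map (g := tnth (Tuple szq))) => [|i]; last exact: permE.
    exact: map_tnth_enum.
  rewrite /cond_pr (big_pred1 (perm inj_q)) => [|s].
    by rewrite def_q drop_size.
  rewrite andbT prefixE (eqP szq) take_oversize ?size_word //.
  apply/eqP/eqP => [def_s | ->]; last exact: def_q.
  by apply/permP => i; rewrite -(nth_word s i i) -(nth_word _ i i) def_s def_q.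
rewrite cond_pr_draw // (eq_bigr (draws_pmf R q)) => [|u _].
  apply: sum_draws; apply/existsP; apply: contraTT ltqn.
  rewrite negb_exists -leqNgt => /forallP allq.
  rewrite -[leqLHS]card_ord -(card_uniqP uq); apply/subset_leq_card/subsetP.
  by move=> c _; have := allq c; rewrite negbK.
have [freeu | /draws_eq0->] := boolP (all (fun c => c \notin q) u); last by rewrite mul0r.
rewrite IHd ?mulr1 //.
  by rewrite size_rcons -ltnS (leq_trans _ ltd) // ltnS ltn_sub2l.
rewrite rcons_uniq uq andbT; apply: (allP freeu).
by apply: choice_funP; rewrite /admissible uq.
Qed.

Lemma cond_prC S q A : uniq q -> cond_pr S q A = 1 - cond_pr S q (predC A).
Proof.
move=> uq.
suff -> : 1 = cond_pr S q A + cond_pr S q (predC A) by rewrite addrK.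
rewrite -(cond_pr_total S uq) /cond_pr (bigID A) /=.
by congr (_ + _); apply: eq_bigl => s; rewrite andbT.
Qed.

Lemma cond_pr_ge0 S q A : 0 <= cond_pr S q A.
Proof.
apply: sumr_ge0 => s /andP[/prefixP[r def_s] _].
by rewrite ltW // path_gt0 // def_s drop_size_cat // -def_s uniq_word.
Qed.

Lemma cond_pr_le1 S q A : uniq q -> cond_pr S q A <= 1.
Proof. by move=> uq; rewrite cond_prC // lerBlDr lerDl cond_pr_ge0. Qed.

Lemma cond_pr_impossible S q A :
  (forall s, prefix q (word s) -> ~~ A s) -> cond_pr S q A = 0.
Proof.
move=> noA; apply: big_pred0 => s; apply/negP => /andP[/noA/negP notA As].
exact: notA.
Qed.

Lemma cond_pr_certain S q A : uniq q ->
  (forall s, prefix q (word s) -> A s) -> cond_pr S q A = 1.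
Proof.
move=> uq allA; rewrite cond_prC // cond_pr_impossible ?subr0 // => s /allA.
by rewrite /= negbK.
Qed.

(** It is enough that some longer word q' forces A: all its completions have
    positive probability, and there is one because the conditional law given q'
    has total mass 1. *)
Lemma cond_pr_gt0 S q q' A : uniq q' -> prefix q q' ->
  (forall s, prefix q' (word s) -> A s) -> 0 < cond_pr S q A.
Proof.
move=> uq' pre allA.
have [s pre_s] : exists s, prefix q' (word s).
  apply/existsP; apply: contraT; rewrite negb_exists => /forallP none.
  move: (oner_eq0 R); rewrite -(cond_pr_total S uq') cond_pr_impossible ?eqxx //.
  by move=> s pre_s; have := none s; rewrite pre_s.
rewrite /cond_pr (bigD1 s) /=; last by rewrite (prefix_trans pre) ?allA.
rewrite ltr_wpDr //.
  apply: sumr_ge0 => s' /andP[/andP[/prefixP[r def_s] _] _].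
  by rewrite ltW // path_gt0 // def_s drop_size_cat // -def_s uniq_word.
have /prefixP[r def_s] := prefix_trans pre pre_s.
by rewrite path_gt0 // def_s drop_size_cat // -def_s uniq_word.
Qed.

Lemma cond_pr_lt1 S q q' A : uniq q' -> prefix q q' ->
  (forall s, prefix q' (word s) -> ~~ A s) -> cond_pr S q A < 1.
Proof.
move=> uq' pre noA; rewrite cond_prC ?(prefix_uniq pre uq') //.
by rewrite ltrBlDr ltrDl (cond_pr_gt0 S uq' pre).
Qed.

End Law.

(** * Changing a single decision *)

Section Switch.

Variables (R : realType) (k n : nat) (S : strategy k n).
Variables (p : seq 'I_n) (u0 : k.-tuple 'I_n) (b : 'I_n).
Hypotheses (adm : admissible p u0) (u0b : b \in u0).

Definition switch_fun (q : seq 'I_n) (u : k.-tuple 'I_n) : 'I_n :=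
  if (q == p) && (u == u0) then b else S q u.

Lemma switch_funP q u : admissible q u -> switch_fun q u \in u.
Proof.
rewrite /switch_fun; case: ifP => [/andP[_ /eqP->] // | _].
exact: choice_funP.
Qed.

Definition switch : strategy k n := Strategy switch_funP.

(** Once the word q has left p or outgrown it, the altered decision can no longer
    occur. *)
Lemma path_switch q r : ~~ prefix q p -> path_pmf R switch q r = path_pmf R S q r.
Proof.
elim: r q => //= c r IHr q notp; rewrite IHr.
  congr (_ * _); apply: eq_bigl => u; rewrite /= /switch_fun.
  by case: (q =P p) notp => // ->; rewrite prefix_refl.
by apply: contra notp; apply: prefix_trans (prefix_rcons _ _).
Qed.

Lemma cond_pr_switch q A : ~~ prefix q p -> cond_pr R switch q A = cond_pr R S q A.
Proof. by move=> notp; apply: eq_bigr => s _; rewrite path_switch. Qed.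

(** Backward induction along p. At p itself only the draw u0 makes a difference;
    before p, only the draws that lead one step further along p do. The weight w
    is the probability, given q, to follow p to its end and then to draw u0. *)
Lemma cond_pr_switch_diff A q r : (size p < n)%N -> q ++ r = p ->
  exists2 w, 0 < w & cond_pr R switch q A - cond_pr R S q A =
    w * (cond_pr R S (rcons p b) A - cond_pr R S (rcons p (S p u0)) A).
Proof.
move=> ltpn.
have up : uniq p by case/andP: adm.
have not_longer c : ~~ prefix (rcons p c) p.
  by apply/negP => /size_prefix; rewrite size_rcons ltnn.
elim: r q => [|c r IHr] q.
  rewrite cats0 => ->; exists (draws_pmf R p u0); first exact: draws_gt0.
  rewrite (cond_pr_draw R switch A up ltpn) (cond_pr_draw R S A up ltpn) -sumrB.
  rewrite (bigD1 u0) //= big1 ?addr0.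
    by rewrite /= /switch_fun !eqxx cond_pr_switch // mulrBr.
  move=> u /negbTE ne_u.
  by rewrite /= /switch_fun eqxx ne_u cond_pr_switch // subrr.
move=> def_p; rewrite -cat_rcons in def_p.
have [w w_gt0 IH] := IHr _ def_p.
have := up; rewrite -{1}def_p cat_uniq rcons_uniq => /andP[/andP[freec uq] _].
have ltqp : (size q < size p)%N by rewrite -def_p size_cat size_rcons ltnS leq_addr.
have ne_qp : (q == p) = false by apply/eqP => eq_qp; rewrite eq_qp ltnn in ltqp.
exists (next_pmf R S q c * w); first by rewrite mulr_gt0 ?next_gt0.
have ltqn := ltn_trans ltqp ltpn.
rewrite (cond_pr_draw R switch A uq ltqn) (cond_pr_draw R S A uq ltqn) -sumrB.
rewrite -mulrA -IH /next_pmf mulr_suml.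
rewrite [RHS]big_mkcond; apply: eq_bigr => u _ /=.
rewrite /= /switch_fun ne_qp /= -mulrBr; case: eqP => [-> // | ne_c].
rewrite cond_pr_switch ?subrr ?mulr0 //; apply/negP => /prefixP[r' def_p'].
move: def_p'; rewrite -def_p !cat_rcons => /eqP.
by rewrite eqseq_cat // eqxx /= eqseq_cons => /andP[/eqP/esym].
Qed.

Lemma Pr_switch A : (size p < n)%N ->
  exists2 w, 0 < w & Pr R switch A - Pr R S A =
    w * (cond_pr R S (rcons p b) A - cond_pr R S (rcons p (S p u0)) A).
Proof. by move=> ltpn; rewrite !Pr_cond_pr; apply: (@cond_pr_switch_diff A [::] p). Qed.

Lemma Pr_switch_le A : (size p < n)%N ->
  cond_pr R S (rcons p (S p u0)) A <= cond_pr R S (rcons p b) A ->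
  Pr R S A <= Pr R switch A.
Proof.
move=> /(Pr_switch A)[w w_gt0 diff] le_ab.
by rewrite -subr_ge0 diff pmulr_rge0 // subr_ge0.
Qed.

Lemma Pr_switch_lt A : (size p < n)%N ->
  cond_pr R S (rcons p (S p u0)) A < cond_pr R S (rcons p b) A ->
  Pr R S A < Pr R switch A.
Proof.
move=> /(Pr_switch A)[w w_gt0 diff] lt_ab.
by rewrite -subr_gt0 diff pmulr_rgt0 // subr_gt0.
Qed.

End Switch.

(** * Draws with two cards *)

Section TwoCardDraw.

Variables (k n : nat) (hk : (2 <= k)%N) (a b : 'I_n).

(** For k >= 2 this draw leaves a genuine choice between a and b, and no other. *)
Definition two_card_draw : k.-tuple 'I_n :=
  [tuple if val i == 0 then a else b | i < k].

Lemma two_card_drawP c : c \in two_card_draw -> c = a \/ c = b.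
Proof.
by move=> /tnthP[i ->]; rewrite tnth_mktuple; case: ifP; [left | right].
Qed.

Lemma two_card_draw_left : a \in two_card_draw.
Proof. by apply/tnthP; exists (Ordinal (ltnW hk)); rewrite tnth_mktuple. Qed.

Lemma two_card_draw_right : b \in two_card_draw.
Proof. by apply/tnthP; exists (Ordinal hk); rewrite tnth_mktuple. Qed.

Lemma admissible_two_card_draw p :
  uniq p -> a \notin p -> b \notin p -> admissible p two_card_draw.
Proof.
move=> up freea freeb; rewrite /admissible up /=.
by apply/allP => c /two_card_drawP[] ->.
Qed.

Lemma min_two_card_draw : (a < b)%N -> min_card (ltnW hk) two_card_draw = a.
Proof.
move=> ltab; rewrite /min_card; case: arg_minnP => // i _ /(_ (Ordinal (ltnW hk)) isT).
by rewrite !tnth_mktuple /=; case: ifP => // _; rewrite leqNgt ltab.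
Qed.

End TwoCardDraw.

(** * Optimality and the minimum strategy *)

Theorem proposition5 (R : realType) :
  (forall k n : nat, (2 <= k)%N -> (5 <= n)%N ->
     ~ exists S : strategy k n, stochastically_optimal R S)
  /\
  (forall (k n : nat) (hk : (2 <= k)%N), (4 <= n)%N ->
     exists S_copy : strategy k n,
       strictly_better R S_copy (card_min_strategy n (ltnW hk))).
Proof.
split=> [k n hk le5n [S optS] | k n hk le4n].
  have [m def_n] : exists m, n = (m + 4).+1.
    by exists (n - 5)%N; rewrite -addnS subnK.
  subst n.
  pose p := tail_word m 4 [:: 2].
  pose a : 'I_(m + 4).+1 := inord (m + 0); pose b : 'I_(m + 4).+1 := inord (m + 3).
  have up : uniq p by apply: uniq_tail_word.
  have freea : a \notin p by rewrite mem_tail_word.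
  have freeb : b \notin p by rewrite mem_tail_word.
  have ltpn : (size p < (m + 4).+1)%N by rewrite size_tail_word ltnS leq_add2l.
  pose u0 := two_card_draw k a b.
  have adm : admissible p u0 by apply: admissible_two_card_draw.
  (* Whichever of a, b the strategy takes on u0 after p, one threshold punishes
     it: the certain m + 3 if it takes a, the possible m + 4 if it takes b. *)
  have [Sa | Sb] := two_card_drawP (choice_funP S adm).
    pose S' := switch S p (two_card_draw_right hk a b).
    have := optS S' (m + 3)%:R; apply/negP; rewrite -ltNge.
    apply: Pr_switch_lt => //; rewrite Sa !rcons_tail_word /=.
    rewrite [ltRHS]cond_pr_certain ?uniq_tail_word // => [|s pre_s].
      apply: (@cond_pr_lt1 _ _ _ _ _ (tail_word m 4 [:: 2; 0; 4; 3])).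
      - exact: uniq_tail_word.
      - exact: prefix_tail_word.
      move=> s pre_s; rewrite ler_nat -ltnNge.
      apply: (@leq_ltn_trans (m + 2)); last by rewrite ltn_add2l.
      by apply: (lis_le_tail (color := nth 0 [:: 0; 1; 0; 1; 1])) pre_s.
    by rewrite ler_nat; apply: (lis_ge_tail (K := [:: 2; 3; 4])) pre_s.
  pose S' := switch S p (two_card_draw_left hk a b).
  have := optS S' (m + 4)%:R; apply/negP; rewrite -ltNge.
  apply: Pr_switch_lt => //; rewrite Sb !rcons_tail_word /=.
  rewrite [ltLHS]cond_pr_impossible => [|s pre_s].
    apply: (@cond_pr_gt0 _ _ _ _ _ (tail_word m 4 [:: 2; 0; 1; 3])).
    - exact: uniq_tail_word.
    - exact: prefix_tail_word.
    move=> s pre_s; rewrite ler_nat.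
    by apply: (lis_ge_tail (K := [:: 0; 1; 3; 4])) pre_s.
  rewrite ler_nat -ltnNge.
  apply: (@leq_ltn_trans (m + 3)); last by rewrite ltn_add2l.
  by apply: (lis_le_tail (color := nth 0 [:: 0; 1; 0; 1; 2])) pre_s.
have [m def_n] : exists m, n = (m + 3).+1.
  by exists (n - 4)%N; rewrite -addnS subnK.
subst n; set Smin := card_min_strategy _ _.
pose p := tail_word m 3 [:: 1].
pose a : 'I_(m + 3).+1 := inord (m + 0); pose b : 'I_(m + 3).+1 := inord (m + 2).
have up : uniq p by apply: uniq_tail_word.
have freea : a \notin p by rewrite mem_tail_word.
have freeb : b \notin p by rewrite mem_tail_word.
have ltpn : (size p < (m + 3).+1)%N by rewrite size_tail_word ltnS leq_add2l.
pose u0 := two_card_draw k a b.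
have adm : admissible p u0 by apply: admissible_two_card_draw.
have Sa : Smin p u0 = a.
  by apply: min_two_card_draw; rewrite !inord_tail // ltn_add2l.
have lis_b s : prefix (tail_word m 3 [:: 1; 2]) (word s) -> (m + 3 <= lis s)%N.
  by apply: (lis_ge_tail (K := [:: 1; 2; 3])).
have lis_a s : prefix (tail_word m 3 [:: 1; 0]) (word s) -> (lis s <= m + 3)%N.
  by apply: (lis_le_tail (color := nth 0 [:: 0; 0; 1; 2])).
exists (switch Smin p (two_card_draw_right hk a b)); split=> [x | ].
  apply: Pr_switch_le => //; rewrite Sa !rcons_tail_word /=.
  (* Up to the threshold m + 3 the card b is a sure win; above it a never wins. *)
  have [le_x | lt_x] := lerP x (m + 3)%:R.
    rewrite [leRHS]cond_pr_certain ?cond_pr_le1 ?uniq_tail_word // => s /lis_b.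
    by rewrite -(ler_nat R); apply: le_trans.
  rewrite [leLHS]cond_pr_impossible ?cond_pr_ge0 // => s /lis_a.
  by rewrite -ltNge -(ler_nat R) => /le_lt_trans; apply.
exists (m + 3)%:R; apply: Pr_switch_lt => //; rewrite Sa !rcons_tail_word /=.
rewrite [ltRHS]cond_pr_certain ?uniq_tail_word // => [|s /lis_b]; last first.
  by rewrite ler_nat.
apply: (@cond_pr_lt1 _ _ _ _ _ (tail_word m 3 [:: 1; 0; 3])).
- exact: uniq_tail_word.
- exact: prefix_tail_word.
move=> s pre_s; rewrite ler_nat -ltnNge.
apply: (@leq_ltn_trans (m + 2)); last by rewrite ltn_add2l.
by apply: (lis_le_tail (color := nth 0 [:: 0; 0; 1; 1])) pre_s.
Qed.
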